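(* Let $V=\mathbb{C}^4$ and let $G<\mathbb{C}^\times\times\mathbb{C}^\times<\mathrm{GL}_2(\mathbb{C})<\mathrm{Sp}_4(\mathbb{C})$ be one of the following groups ($r,m,A,B\ge1$ integers). The Hilbert series $h:=h(\mathsf{HP}_0(\mathcal{O}_V^G,\mathcal{O}_V);t)$ is as follows. (1) $G$ is cyclic, generated by $\mathrm{diag}(e^{2\pi i/m},e^{\pm2r\pi i/m})$, where $\gcd(r,m)=1$, either $r\mid(m+1)$ or $r\mid(m-1)$, and $r\not\equiv\pm1\pmod m$. Let $p,q$ be the integers with $1<p,q<m/2$, $p\equiv\pm r\pmod m$ and $pq=m\pm1$; without loss of generality (up to conjugating $G$ by the nontrivial permutation matrix) assume $p\le q$. If $pq+1=m$, then $$h=\sum_{j=0}^{p-1}(j+1)t^{2j}+\sum_{j=p}^{q-1}p\,t^{2j}+\sum_{j=q}^{p+q-2}(p+q-1-j)t^{2j}.$$ If $pq-1=m$, then $$h=\sum_{j=0}^{p-1}(j+1)t^{2j}+\sum_{j=p}^{q-1}p\,t^{2j}+\sum_{j=q}^{p+q-4}(p+q-1-j)t^{2j}+t^{2p+2q-6}.$$ (2) $G$ is cyclic, generated by $\mathrm{diag}(e^{\pm2\pi i/(mA)},e^{2\pi i/m})$. If $m\le A$, then $$h=\sum_{j=0}^{m-2}(j+1)t^{2j}+\sum_{j=m-1}^{A-1}(m-1)t^{2j}+\sum_{j=A}^{m+A-3}(m+A-2-j)t^{2j};$$ if $m>A$, then $$h=\sum_{j=0}^{A-1}(j+1)t^{2j}+\sum_{j=A}^{m-2}A\,t^{2j}+\sum_{j=m-1}^{m+A-3}(m+A-2-j)t^{2j}.$$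 (3) $G$ is generated by $\mathrm{diag}(e^{2\pi i/A},1)$ and $\mathrm{diag}(1,e^{2\pi i/B})$; without loss of generality $A\ge B$. Then $$h=\sum_{j=0}^{B-2}(j+1)t^{2j}+\sum_{j=B-1}^{A-2}(B-1)t^{2j}+\sum_{j=A-1}^{A+B-4}(A+B-3-j)t^{2j}.$$
   Context: $V=X\oplus X^*$, $X=\mathbb{C}^2$, with its standard symplectic form, and $\mathrm{GL}_2(\mathbb{C})=\mathrm{GL}(X)<\mathrm{Sp}(V)$ via $M\mapsto M\oplus(M^{-1})^*$. $\mathcal{O}_V$ is the algebra of polynomial functions on $V$ with the Poisson bracket induced by the symplectic form, graded by polynomial degree. $\mathsf{HP}_0(\mathcal{O}_V^G,\mathcal{O}_V):=\mathcal{O}_V/\{\mathcal{O}_V^G,\mathcal{O}_V\}$ (quotient by the linear span of brackets), with the induced grading, and $h(K;t)=\sum_i\dim K_i\,t^i$. Sums whose upper limit is smaller than the lower limit are empty. *)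

(* Defs.v *)
From HB Require Import structures.
From mathcomp Require Import all_boot all_order all_algebra complex ring_quotient.
From mathcomp Require Import boolp reals mpoly zify.
From mathcomp Require trigo.

Set Implicit Arguments.
Unset Strict Implicit.
Unset Printing Implicit Defensive.
Import GRing.Theory.
Local Open Scope ring_scope.
Local Open Scope quotient_scope.

Section LinearSpan.
Context {K : fieldType} {W : lmodType K}.

Definition lin_span (S : W -> Prop) : {pred W} := fun v =>
  `[< exists (n : nat) (c : 'I_n -> K) (w : 'I_n -> W),
        (forall i, S (w i)) /\ v = \sum_(i < n) c i *: w i >].

Lemma lin_span_submod S : submod_closed (lin_span S).
Proof.
split.
  apply/asboolP; exists 0%N, (fun=> 0), (fun=> 0).
  by split; [case | rewrite big_ord0].
move=> a u v /asboolP [n [c [w [Sw ->]]]] /asboolP [n' [c' [w' [Sw' ->]]]].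
apply/asboolP; exists (n + n')%N.
exists (fun k => match split k with inl i => a * c i | inr j => c' j end).
exists (fun k => match split k with inl i => w i | inr j => w' j end).
split; first by move=> k; case: (split k).
rewrite big_split_ord /= scaler_sumr; congr (_ + _); apply: eq_bigr => i _.
  by rewrite (unsplitK (inl _ i)) scalerA.
by rewrite (unsplitK (inr _ i)).
Qed.

HB.instance Definition _ S :=
  GRing.isSubmodClosed.Build K W (lin_span S) (lin_span_submod S).

Definition span_quot (S : W -> Prop) : Type := Quotient.quot (lin_span S).
HB.instance Definition _ S := GRing.Zmodule.on (span_quot S).

Definition to_span_quot (S : W -> Prop) (v : W) : span_quot S :=
  \pi_(Quotient.quot (lin_span S)) v.

Definition span_quot_scale S (a : K) (x : span_quot S) : span_quot S :=
  to_span_quot S (a *: repr x).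

Lemma to_span_quot_eq S v w :
  (to_span_quot S v == to_span_quot S w) = (v - w \in lin_span S).
Proof. by rewrite [RHS]Quotient.idealrBE. Qed.

Lemma to_span_quotK S (x : span_quot S) : to_span_quot S (repr x) = x.
Proof. exact: reprK. Qed.

Lemma to_span_quotD S : {morph to_span_quot S : v w / v + w}.
Proof. by move=> v w; rewrite /to_span_quot piE. Qed.

Lemma span_quot_scaleE S a v :
  span_quot_scale a (to_span_quot S v) = to_span_quot S (a *: v).
Proof.
apply/eqP; rewrite to_span_quot_eq -scalerBr rpredZ //.
by rewrite -to_span_quot_eq to_span_quotK.
Qed.

Lemma span_quot_scaleA S a b (x : span_quot S) :
  span_quot_scale a (span_quot_scale b x) = span_quot_scale (a * b) x.
Proof.
by rewrite -[x]to_span_quotK !span_quot_scaleE scalerA.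
Qed.

Lemma span_quot_scale1 S : left_id 1 (@span_quot_scale S).
Proof. by move=> x; rewrite -[x]to_span_quotK span_quot_scaleE scale1r. Qed.

Lemma span_quot_scaleDr S : right_distributive (@span_quot_scale S) +%R.
Proof.
move=> a x y; rewrite -[x]to_span_quotK -[y]to_span_quotK.
by rewrite -to_span_quotD !span_quot_scaleE scalerDr to_span_quotD.
Qed.

Lemma span_quot_scaleDl S (x : span_quot S) :
  {morph (@span_quot_scale S)^~ x : a b / a + b}.
Proof.
move=> a b; rewrite -[x]to_span_quotK !span_quot_scaleE scalerDl.
exact: to_span_quotD.
Qed.

HB.instance Definition _ S := GRing.Zmodule_isLmodule.Build K (span_quot S)
  (@span_quot_scaleA S) (@span_quot_scale1 S) (@span_quot_scaleDr S)
  (@span_quot_scaleDl S).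

Lemma to_span_quot_linear S : linear (to_span_quot S).
Proof. by move=> a v w; rewrite to_span_quotD -span_quot_scaleE. Qed.

HB.instance Definition _ S := GRing.isLinear.Build K W (span_quot S) _
  (to_span_quot S) (to_span_quot_linear S).

(* The linear subspace P of W has dimension n. *)
Definition has_dim (P : W -> Prop) (n : nat) : Prop :=
  exists e : 'I_n -> W,
    [/\ forall i, P (e i),
        forall c : 'I_n -> K, \sum_(i < n) c i *: e i = 0 -> forall i, c i = 0
      & forall v, P v -> exists c : 'I_n -> K, v = \sum_(i < n) c i *: e i].

End LinearSpan.

Section Poisson.
Context {K : fieldType}.

(* Coordinates on V = X (+) X^*, with X = K^2: 'X_(lshift 2 i) is the i-th
   coordinate on X and 'X_(rshift 2 i) the dual coordinate on X^*. *)
Local Notation OV := {mpoly K[(2 + 2)%N]}.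

(* Normalized so that {x_i, y_j} = delta_ij. *)
Definition poisson (f g : OV) : OV :=
  \sum_(i < 2) (f^`M(lshift 2 i) * g^`M(rshift 2 i)
                - f^`M(rshift 2 i) * g^`M(lshift 2 i)).

(* M |-> M (+) (M^-1)^*, acting on column vectors of V. *)
Definition sp_of_gl (M : 'M[K]_2) : 'M[K]_(2 + 2) :=
  block_mx M 0 0 (invmx M)^T.

(* The polynomial function v |-> f (A *m v). *)
Definition precomp (A : 'M[K]_(2 + 2)) (f : OV) : OV :=
  f \mPo [tuple \sum_(j < 2 + 2) A i j *: 'X_j | i < 2 + 2].

(* The generated subgroup of GL_2, for S a set of invertible matrices (invmx is
   the identity on singular ones). *)
Inductive generated (S : 'M[K]_2 -> Prop) : 'M[K]_2 -> Prop :=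
| generated_in M : S M -> generated S M
| generated_1 : generated S 1%:M
| generated_mul M N : generated S M -> generated S N -> generated S (M *m N)
| generated_inv M : generated S M -> generated S (invmx M).

Definition diag2 (a b : K) : 'M[K]_2 :=
  diag_mx (\row_(i < 2) if i == ord0 then a else b).

Definition invariant (G : 'M[K]_2 -> Prop) (f : OV) : Prop :=
  forall M, G M -> precomp (sp_of_gl M) f = f.

Definition bracket_with_invariant (G : 'M[K]_2 -> Prop) (h : OV) : Prop :=
  exists f g : OV, invariant G f /\ h = poisson f g.

Definition HP0 (G : 'M[K]_2 -> Prop) : lmodType K :=
  span_quot (bracket_with_invariant G).

(* The degree d component of HP0 G: the image of the degree d forms. *)
Definition HP0_deg (G : 'M[K]_2 -> Prop) (d : nat) (x : HP0 G) : Prop :=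
  exists2 f : OV, f \is d.-homog & x = to_span_quot (bracket_with_invariant G) f.

(* dim HP0_d = [t^d] h for all d; in particular each HP0_d is
   finite-dimensional. *)
Definition HP0_hilbert_series (G : 'M[K]_2 -> Prop) (h : {poly nat}) : Prop :=
  forall d : nat, has_dim (@HP0_deg G d) (h`_d)%R.

End Poisson.

(* e^(ix) *)
Definition expi (R : realType) (x : R) : R[i] := (trigo.cos x +i* trigo.sin x)%C.

(* Such p and q are determined by r and m; they exist by cyclic_pair_exists. *)
Definition cyclic_pair (m r p q : nat) : Prop :=
  [/\ (1 < p)%N /\ (2 * p < m)%N,
      (1 < q)%N /\ (2 * q < m)%N,
      (p = r %[mod m])%Z \/ (p = - r%:Z %[mod m])%Z
    & (p * q + 1 = m)%N \/ (p * q = m + 1)%N].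

Lemma cyclic_pair_exists (m r : nat) :
  (0 < r)%N -> (0 < m)%N -> coprime r m ->
  (r %| m + 1)%N \/ (r %| m - 1)%N ->
  (r != 1 %[mod m])%Z -> (r != - 1 %[mod m])%Z ->
  exists p q : nat, cyclic_pair m r p q.
Proof.
move=> r0 m0 co rm r1 rN1.
have m1 : (1 < m)%N.
  by case: m m0 r1 {rm rN1 co} => [|[|m]] // _; rewrite !modz1.
have rn1 : r <> 1%N by move=> e; rewrite e eqxx in r1.
have rnm : (r + 1)%N <> m.
  move=> e; case/negP: rN1; rewrite eqz_mod_dvd opprK.
  by rewrite -PoszD e dvdzz.
have rnm1 : r <> (m + 1)%N.
  move=> e; case/negP: r1; rewrite eqz_mod_dvd e PoszD addrK.
  exact: dvdzz.
have rnm2 : r <> m by move=> e; move: co; rewrite e /coprime gcdnn; lia.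
have rle : (r <= m)%N.
  case: rm => [/dvdn_leq|/dvdn_leq]; lia.
case: rm => /dvdnP [k ek]; last first.
  have k1 : k <> 1%N by move=> e; subst k; lia.
  have k0 : k <> 0%N by move=> e; subst k; lia.
  have rge : (2 <= r)%N by lia.
  have kge : (2 <= k)%N by lia.
  exists r, k; split; [split; nia | split; nia | by left | left; nia].
have k0 : k <> 0%N by move=> e; subst k; lia.
have k1 : k <> 1%N by move=> e; subst k; lia.
have rge : (2 <= r)%N by lia.
have [r2|r2] := eqVneq r 2.
  subst r.
  exists 2, (k - 1)%N; split; [split; lia | split; lia | by left | left; lia].
have [k2|k2] := eqVneq k 2.
  subst k; exists (m - r)%N, 2.
  split; [split; lia | split; lia | right | left; lia].
  by apply/eqP; rewrite eqz_mod_dvd opprK -PoszD subnK ?dvdzz.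
exists r, k; split; [split; nia | split; nia | by left | right; lia].
Qed.

(* Main.v *)
(* G acts diagonally, so the torus acts on HP0.  Bracketing with the invariants
   u_n = x_n y_n kills every monomial of nonzero weight, and HP0 is spanned by the
   u_1^i u_2^j.  If Lambda is the lattice of weights of invariant monomials, the
   remaining relations are
     k P u_1^(P-1) u_2^Q + l Q u_1^P u_2^(Q-1) = 0,
   one for each (k, l) in Lambda with |k| <= P and |l| <= Q.  In degree 2d they
   involve only neighbours on the path u_2^d, u_1 u_2^(d-1), ..., u_1^d: the box
   [-P, P] x [-Q, Q] with P + Q = d + 1 either contains no vector of Lambda, or
   multiples of a single non-axial one (which identifies two neighbours up to a
   nonzero scalar), or vectors that kill one or both of them.  Hence the dimension
   is the number of components of the path without killed vertices, and it remains
   to list the short vectors of Lambda: near the critical degree these are the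
   multiples of (p, 1), (1, -q) if m = pq + 1; of (p, 1), (1, q), (p - 1, 1 - q) if
   m = pq - 1; of (A, 1), (0, m) in case (2); and of (A, 0), (0, B) in case (3). *)

From HB Require Import structures.
Require Import Defs.
From mathcomp Require Import all_boot all_order all_algebra complex.
From mathcomp Require Import boolp reals mpoly.
From mathcomp Require Import zify ring lra.
From mathcomp Require trigo.
Import Order.TTheory GRing.Theory Num.Theory.
Local Open Scope ring_scope.
Set Implicit Arguments.
Unset Strict Implicit.
Unset Printing Implicit Defensive.

(** * Brackets of monomials *)

Section Monomials.
Variable K : numFieldType.
Local Notation OV := {mpoly K[(2 + 2)%N]}.
Local Notation mnm := 'X_{1..(2 + 2)%N}.

Lemma ord22_ind (P : 'I_(2 + 2) -> Prop) :
  (forall i : 'I_2, P (lshift 2 i)) -> (forall i : 'I_2, P (rshift 2 i)) ->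
  forall k, P k.
Proof.
by move=> Pl Pr k; rewrite -(splitK k); case: (split k) => i; [apply: Pl|apply: Pr].
Qed.

Lemma ord2P (i : 'I_2) : i = 0 \/ i = 1.
Proof. by case: i => [[|[|]]] // h; [left|right]; apply: val_inj. Qed.

Definition wt (m : mnm) (i : 'I_2) : int :=
  (m (lshift 2 i))%:Z - (m (rshift 2 i))%:Z.

(* The exponent of u_1^i u_2^j, where u_n = x_n y_n. *)
Definition bal (i j : nat) : mnm := [multinom if odd k then j else i | k < 2 + 2].

Lemma bal_l i j (n : 'I_2) : bal i j (lshift 2 n) = if n == 0 then i else j.
Proof. by rewrite mnmE; case: n => [[|[|]]]. Qed.

Lemma bal_r i j (n : 'I_2) : bal i j (rshift 2 n) = if n == 0 then i else j.
Proof. by rewrite mnmE; case: n => [[|[|]]]. Qed.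

Lemma bal_inj i j i' j' : bal i j = bal i' j' -> i = i' /\ j = j'.
Proof.
move=> /mnmP e; split.
  by have := e (lshift 2 0); rewrite !bal_l.
by have := e (lshift 2 1); rewrite !bal_l.
Qed.

Lemma mdeg_bal i j : mdeg (bal i j) = (2 * (i + j))%N.
Proof. by rewrite mdegE !big_ord_recl big_ord0 !mnmE /=; lia. Qed.

Lemma wt0_bal m : wt m 0 = 0 -> wt m 1 = 0 ->
  m = bal (m (lshift 2 0)) (m (lshift 2 1)).
Proof.
rewrite /wt => e0 e1; apply/mnmP; apply: ord22_ind => i.
  by rewrite bal_l; case: (ord2P i) => ->.
by rewrite bal_r; case: (ord2P i) => -> /=; lia.
Qed.

(** Both terms of the i-th summand remove x_i y_i from the product, so they share a monomial. Where
    the truncated subtraction of exponents fails, the coefficient is zero. *)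
Lemma poisson_mon (m m' : mnm) :
  poisson ('X_[m] : OV) 'X_[m'] =
  \sum_(i < 2)
    ((m (lshift 2 i))%:Z * m' (rshift 2 i)
     - (m (rshift 2 i))%:Z * m' (lshift 2 i))%:~R
    *: 'X_[m + m' - U_(lshift 2 i) - U_(rshift 2 i)].
Proof.
apply: eq_bigr => i _; rewrite !mderivX -!scalerAl -!scalerAr !scalerA -!mpolyXD.
rewrite intrB !intrM scalerBl; congr (_ - _).
  case: (posnP (m (lshift 2 i))) => [->|h1]; first by rewrite !mul0r !scale0r.
  case: (posnP (m' (rshift 2 i))) => [->|h2]; first by rewrite !mulr0 !scale0r.
  congr (_ *: 'X_[_]); apply/mnmP => k; rewrite !(mnmDE, mnmBE, mnm1E).
  case: eqP => [<-|_]; case: eqP => [e|_] //=; [|lia|subst k; lia|lia].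
  by move/eqP: e; rewrite eq_rlshift.
case: (posnP (m (rshift 2 i))) => [->|h1]; first by rewrite !mul0r !scale0r.
case: (posnP (m' (lshift 2 i))) => [->|h2]; first by rewrite !mulr0 !scale0r.
congr (_ *: 'X_[_]); apply/mnmP => k; rewrite !(mnmDE, mnmBE, mnm1E).
case: eqP => [<-|_]; case: eqP => [e|_] //=; [|lia|subst k; lia|lia].
by move/eqP: e; rewrite eq_lrshift.
Qed.

Lemma poissonDl (f f' g : OV) : poisson (f + f') g = poisson f g + poisson f' g.
Proof.
rewrite -big_split; apply: eq_bigr => i _ /=.
by rewrite !mderivD !mulrDl opprD addrACA.
Qed.

Lemma poissonZl c (f g : OV) : poisson (c *: f) g = c *: poisson f g.
Proof.
rewrite scaler_sumr; apply: eq_bigr => i _ /=.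
by rewrite !mderivZ -!scalerAl -scalerBr.
Qed.

Lemma poissonDr (f g g' : OV) : poisson f (g + g') = poisson f g + poisson f g'.
Proof.
rewrite -big_split; apply: eq_bigr => i _ /=.
by rewrite !mderivD !mulrDr opprD addrACA.
Qed.

Lemma poissonZr c (f g : OV) : poisson f (c *: g) = c *: poisson f g.
Proof.
rewrite scaler_sumr; apply: eq_bigr => i _ /=.
by rewrite !mderivZ -!scalerAr -scalerBr.
Qed.

Lemma poisson_monE (f g : OV) :
  poisson f g = \sum_(m <- msupp f) \sum_(m' <- msupp g)
    (f@_m * g@_m') *: poisson ('X_[m] : OV) 'X_[m'].
Proof.
have poisson0l (h : OV) : poisson 0 h = 0 by have := poissonZl 0 0 h; rewrite !scale0r.
have poisson0r (h : OV) : poisson h 0 = 0 by have := poissonZr 0 h 0; rewrite !scale0r.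
rewrite {1}(mpolyE f).
have -> : poisson (\sum_(m <- msupp f) f@_m *: 'X_[m]) g =
    \sum_(m <- msupp f) f@_m *: poisson 'X_[m] g.
  elim: (msupp f) => [|m s IH]; first by rewrite !big_nil.
  by rewrite !big_cons poissonDl poissonZl IH.
apply: eq_bigr => m _; rewrite {1}(mpolyE g).
have -> : poisson 'X_[m] (\sum_(m' <- msupp g) g@_m' *: 'X_[m']) =
    \sum_(m' <- msupp g) g@_m' *: poisson ('X_[m] : OV) 'X_[m'].
  elim: (msupp g) => [|m' s IH]; first by rewrite !big_nil.
  by rewrite !big_cons poissonDr poissonZr IH.
by rewrite scaler_sumr; apply: eq_bigr => m' _; rewrite scalerA.
Qed.

End Monomials.

(** * Invariants of a diagonal group *)

Section Invariants.
Variable K : numFieldType.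
Local Notation OV := {mpoly K[(2 + 2)%N]}.
Local Notation mnm := 'X_{1..(2 + 2)%N}.

Lemma mul_diag2 (a b c d : K) : diag2 a b *m diag2 c d = diag2 (a * c) (b * d).
Proof.
apply/matrixP => i j; rewrite /diag2 mulmx_diag !mxE.
by case: (i == ord0); case: (i == j).
Qed.

Lemma diag2_1 : diag2 1 1 = 1%:M :> 'M[K]_2.
Proof. by apply/matrixP => i j; rewrite !mxE; case: (i == ord0). Qed.

Lemma invmx_diag2 (a b : K) : a != 0 -> b != 0 ->
  invmx (diag2 a b) = diag2 a^-1 b^-1.
Proof.
move=> a0 b0; have e : diag2 a b *m diag2 a^-1 b^-1 = 1%:M.
  by rewrite mul_diag2 !divff // diag2_1.
have [u _] := mulmx1_unit e.
by rewrite -[LHS]mulmx1 -e mulmxA mulVmx // mul1mx.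
Qed.

Lemma precomp_diag2_mon (a b : K) (m : mnm) : a != 0 -> b != 0 ->
  precomp (sp_of_gl (diag2 a b)) 'X_[m] =
  (a ^ wt m 0 * b ^ wt m 1) *: 'X_[m].
Proof.
move=> a0 b0; rewrite /precomp comp_mpolyX /sp_of_gl invmx_diag2 //.
(* The diagonal a, b, 1/a, 1/b of the matrix acting on V. *)
pose w (k : 'I_(2 + 2)) := match split k with
  | inl i => if i == ord0 then a else b
  | inr i => if i == ord0 then a^-1 else b^-1 end.
rewrite (eq_bigr (fun k => (w k ^+ m k) *: ('X_k ^+ m k))); last first.
  move=> k _; rewrite tnth_mktuple.
  rewrite (bigD1 k) //= big1 ?addr0 => [|j].
    rewrite -exprZn; congr ((_ *: _) ^+ _); rewrite /w.
    move: k; apply: ord22_ind => i.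
      by rewrite block_mxEul !mxE eqxx (unsplitK (inl _ i)).
    by rewrite block_mxEdr !mxE eqxx (unsplitK (inr _ i)).
  move: k j; apply: ord22_ind => i; apply: ord22_ind => j ji.
  - rewrite block_mxEul !mxE; case: (eqVneq i j) ji => [->|_ _]; first by rewrite eqxx.
    by rewrite mulr0n scale0r.
  - by rewrite block_mxEur mxE scale0r.
  - by rewrite block_mxEdl mxE scale0r.
  - rewrite block_mxEdr !mxE; case: (eqVneq i j) ji => [->|_ _]; first by rewrite eqxx.
    by rewrite mulr0n scale0r.
rewrite scaler_prod -mpolyXE_id; congr (_ *: _).
rewrite big_split_ord !big_ord_recl !big_ord0 /= !mulr1 /w.
rewrite !(unsplitK (inl _ _)) !(unsplitK (inr _ _)) /= /wt.
rewrite !expfzDr // -!exprnN -!exprnP !exprVn.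
have -> : lift ord0 ord0 = 1 :> 'I_2 by apply: val_inj.
by rewrite mulrACA.
Qed.

Lemma precomp_diag2_coeff (a b : K) (f : OV) m : a != 0 -> b != 0 ->
  (precomp (sp_of_gl (diag2 a b)) f)@_m = a ^ wt m 0 * b ^ wt m 1 * f@_m.
Proof.
move=> a0 b0; rewrite {2}(mpolyE f) /precomp comp_mpolyEX !raddf_sum /= mulr_sumr.
apply: eq_bigr => m' _.
have := precomp_diag2_mon m' a0 b0; rewrite /precomp => ->.
rewrite !linearZ /= !mcoeffX.
by case: eqP => [->|_]; rewrite ?mulr0 // !mulr1 mulrC.
Qed.

(** [L] is the annihilator of [S] among the characters (k, l) of the diagonal torus. Testing
    generators suffices because characters are multiplicative. *)
Definition trivial_characters (S : 'M[K]_2 -> Prop) (L : int -> int -> bool) :=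
  (forall M, S M -> exists a b, [/\ M = diag2 a b, a != 0, b != 0
     & forall k l, L k l -> a ^ k * b ^ l = 1]) /\
  (forall k l, ~~ L k l -> exists a b, [/\ S (diag2 a b), a != 0, b != 0
     & a ^ k * b ^ l != 1]).

(** A diagonal matrix scales the coefficient at m by a character determined by the weight of m, so
    invariance is a condition on each monomial separately. *)
Lemma invariant_generatedP S L (f : OV) : trivial_characters S L ->
  Defs.invariant (generated S) f <-> forall m, m \in msupp f -> L (wt m 0) (wt m 1).
Proof.
move=> [SL LS]; split=> [finv m|fL].
  rewrite mcoeff_msupp => fm0; apply: contraT => /LS [a [b [Sab a0 b0]]].
  move/negP; case; apply/eqP/(mulIf fm0).
  by rewrite mul1r -precomp_diag2_coeff // (finv _ (generated_in Sab)).
have gL M : generated S M -> exists a b, [/\ M = diag2 a b, a != 0, b != 0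
     & forall k l, L k l -> a ^ k * b ^ l = 1].
  elim=> {M} [M /SL //||M N _ [a [b [-> a0 b0 h]]] _ [c [d [-> c0 d0 h']]]|].
  - by exists 1, 1; split; rewrite ?diag2_1 ?oner_eq0 // => k l _; rewrite !exp1rz mulr1.
  - exists (a * c), (b * d); rewrite mul_diag2 !mulf_neq0 //; split=> // k l kl.
    by rewrite !exprzMl ?unitfE // mulrACA h // h' // mulr1.
  move=> M _ [a [b [-> a0 b0 h]]].
  exists a^-1, b^-1; rewrite invmx_diag2 // !invr_eq0; split=> // k l kl.
  by rewrite !exprz_inv -!invr_expz -invfM h ?invr1.
move=> M /gL [a [b [-> a0 b0 h]]]; apply/mpolyP => m.
rewrite precomp_diag2_coeff //; have [/fL/h ->|] := boolP (m \in msupp f).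
  by rewrite mul1r.
by move=> /memN_msupp_eq0 ->; rewrite mulr0.
Qed.

End Invariants.

(** * The quotient in a fixed degree *)

Section Relations.
Variables (K : numFieldType) (S : 'M[K]_2 -> Prop) (L : int -> int -> bool).
Hypothesis SL : trivial_characters S L.
Local Notation mnm := 'X_{1..(2 + 2)%N}.
Local Notation B := (bracket_with_invariant (generated S)).

Lemma trivial_characters0 : L 0 0.
Proof.
apply: contraT => /(proj2 SL) [a [b [_ _ _]]].
by rewrite !expr0z mulr1 eqxx.
Qed.

Definition mon_class (i j : nat) : HP0 (generated S) := to_span_quot B 'X_[bal i j].

Lemma class_poisson_mon (m m' : mnm) : L (wt m 0) (wt m 1) ->
  to_span_quot B (poisson 'X_[m] 'X_[m']) = 0.
Proof.
move=> Lm; have {1}-> : (0 : HP0 (generated S)) = to_span_quot B 0 by rewrite linear0.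
apply/eqP; rewrite to_span_quot_eq subr0; apply/asboolP.
exists 1%N, (fun=> 1), (fun=> poisson 'X_[m] 'X_[m']).
split; last by rewrite big_ord1 scale1r.
move=> _; exists 'X_[m], 'X_[m']; split=> //.
by apply/(invariant_generatedP _ SL) => m1; rewrite msuppX inE => /eqP ->.
Qed.

(* [{x_n y_n, X^m}] is [X^m] times minus its n-th weight. *)
Lemma class_wt_neq0 (m : mnm) (n : 'I_2) : wt m n != 0 ->
  to_span_quot B 'X_[m] = 0.
Proof.
move=> mn; pose u := bal (n == 0) (n == 1).
have uE k : u (lshift 2 k) = (k == n) /\ u (rshift 2 k) = (k == n).
  by rewrite /u bal_l bal_r; case: (ord2P k) (ord2P n) => -> [] ->.
have wu k : wt u k = 0 by rewrite /wt !(proj1 (uE k), proj2 (uE k)) subrr.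
have := @class_poisson_mon u m; rewrite !wu => /(_ trivial_characters0).
rewrite poisson_mon (bigD1 n) //= big1 ?addr0 => [|k kn]; last first.
  by rewrite !(proj1 (uE k), proj2 (uE k)) (negPf kn) !mul0r subrr scale0r.
rewrite !(proj1 (uE n), proj2 (uE n)) eqxx !mul1r.
have -> : (u + m - U_(lshift 2 n) - U_(rshift 2 n))%MM = m.
  apply/mnmP; apply: ord22_ind => k; rewrite !(mnmBE, mnmDE, mnm1E).
    rewrite (proj1 (uE k)) eq_rlshift eq_lshift eq_sym subn0 addnC; exact: addnK.
  rewrite (proj2 (uE k)) eq_lrshift eq_rshift eq_sym subn0 addnC; exact: addnK.
rewrite linearZ /= -opprB -/(wt m n) => /eqP.
by rewrite scaler_eq0 intr_eq0 oppr_eq0 (negPf mn) => /eqP.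
Qed.

Definition posn (k : int) : nat := if k is Posz n then n else 0.

(** This is the bracket of an invariant monomial of weight (k, l) with its cofactor in u_1^P u_2^Q.
    For P = 0 or Q = 0 the truncated predecessor is harmless, its coefficient being zero. *)
Lemma mon_class_rel (k l : int) (P Q : nat) :
  L k l -> (`|k| <= P)%N -> (`|l| <= Q)%N ->
  (k * P)%:~R *: mon_class P.-1 Q + (l * Q)%:~R *: mon_class P Q.-1 = 0.
Proof.
move=> kl kP lQ.
pose w (n : 'I_2) := if n == 0 then k else l.
(* The smallest monomial of weight (k, l): positive parts are exponents of the x_n, negative parts
   of the y_n. The bounds on k and l make it divide u_1^P u_2^Q. *)
pose m : mnm := [multinom match split i with
  | inl n => posn (w n) | inr n => posn (- w n) end | i < 2 + 2].
have ml n : m (lshift 2 n) = posn (w n) by rewrite mnmE (unsplitK (inl _ _)).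
have mr n : m (rshift 2 n) = posn (- w n) by rewrite mnmE (unsplitK (inr _ _)).
have posnB x : (posn x)%:Z - (posn (- x))%:Z = x by case: x => [[|x]|x] /=; lia.
have mw n : wt m n = w n by rewrite /wt ml mr posnB.
pose PQ (n : 'I_2) := if n == 0 then P else Q.
have le n : (posn (w n) <= PQ n)%N /\ (posn (- w n) <= PQ n)%N.
  rewrite /w /PQ; case: ifP => _.
    by split; case: (k) kP => [[|x]|x] /=; lia.
  by split; case: (l) lQ => [[|x]|x] /=; lia.
have := @class_poisson_mon m (bal P Q - m); rewrite !mw => /(_ kl).
rewrite poisson_mon.
have -> : (m + (bal P Q - m) = bal P Q)%MM.
  apply/mnmP; apply: ord22_ind => n; rewrite mnmDE mnmBE subnKC //.
    by rewrite ml bal_l; case: (le n).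
  by rewrite mr bal_r; case: (le n).
rewrite linear_sum big_ord_recl big_ord1 /=.
have -> : lift ord0 ord0 = 1 :> 'I_2 by apply: val_inj.
have coef n : (m (lshift 2 n))%:Z * (bal P Q - m)%MM (rshift 2 n)
    - (m (rshift 2 n))%:Z * (bal P Q - m)%MM (lshift 2 n)
    = w n * PQ n.
  rewrite !mnmBE bal_l bal_r -/(PQ n) ml mr; have [h1 h2] := le n.
  rewrite -!subzn // -{5}(posnB (w n)); ring.
rewrite !coef !linearZ /= /mon_class.
have -> : (bal P Q - U_(lshift 2 ord0) - U_(rshift 2 ord0) = bal P.-1 Q)%MM.
  apply/mnmP; apply: ord22_ind => n; rewrite !(mnmBE, mnm1E) !(bal_l, bal_r).
    by rewrite eq_rlshift eq_lshift; case: (ord2P n) => -> /=; lia.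
  by rewrite eq_lrshift eq_rshift; case: (ord2P n) => -> /=; lia.
have -> : (bal P Q - U_(lshift 2 1) - U_(rshift 2 1) = bal P Q.-1)%MM.
  apply/mnmP; apply: ord22_ind => n; rewrite !(mnmBE, mnm1E) !(bal_l, bal_r).
    by rewrite eq_rlshift eq_lshift; case: (ord2P n) => -> /=; lia.
  by rewrite eq_lrshift eq_rshift; case: (ord2P n) => -> /=; lia.
by [].
Qed.

End Relations.

(** * Linear functionals that vanish on brackets *)

Section Functionals.
Variables (K : numFieldType) (S : 'M[K]_2 -> Prop) (L : int -> int -> bool).
Hypothesis SL : trivial_characters S L.
Local Notation OV := {mpoly K[(2 + 2)%N]}.
Local Notation mnm := 'X_{1..(2 + 2)%N}.
Local Notation B := (bracket_with_invariant (generated S)).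

(** A test functional that reads only the coefficients of the u_1^i u_2^(d - i); such functionals
    detect linear independence in [HP0]. *)
Definition bal_form (d : nat) (c : nat -> K) (f : OV) : K^o :=
  \sum_(i < d.+1) c i * f@_(bal i (d - i)).

Lemma bal_form_linear d c : linear (bal_form d c).
Proof.
move=> a f g; rewrite /bal_form scaler_sumr -big_split; apply: eq_bigr => i _ /=.
by rewrite mcoeffD mcoeffZ mulrDr mulrCA.
Qed.

HB.instance Definition _ d c :=
  GRing.isLinear.Build K OV K^o _ (bal_form d c) (bal_form_linear d c).

Lemma bal_form_sum d c (I : Type) (r : seq I) (F : I -> OV) :
  bal_form d c (\sum_(i <- r) F i) = \sum_(i <- r) bal_form d c (F i).
Proof. exact: linear_sum. Qed.

Lemma bal_form_bal d c i : (i <= d)%N -> bal_form d c 'X_[bal i (d - i)] = c i.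
Proof.
move=> id; rewrite /bal_form (bigD1 (inord i)) //= inordK ?ltnS //.
rewrite mcoeffX eqxx mulr1 big1 ?addr0 // => j ji.
rewrite mcoeffX; case: eqP => [/bal_inj [e _]|_]; last by rewrite mulr0.
by case/eqP: ji; apply: val_inj; rewrite /= inordK ?ltnS.
Qed.

Lemma bal_form_nbal d c m : (forall i, (i <= d)%N -> m <> bal i (d - i)) ->
  bal_form d c 'X_[m] = 0.
Proof.
move=> nm; rewrite /bal_form big1 // => i _.
by rewrite mcoeffX; case: eqP => [/nm|_]; [rewrite -ltnS ltn_ord => /(_ isT)|rewrite mulr0].
Qed.

(** The equations dual to [mon_class_rel] with Q = d + 1 - P. At P = 0 the first term and at P = d +
    1 the second one is multiplied by zero. *)
Definition compatible (d : nat) (c : nat -> K) :=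
  forall (k l : int) P, (P <= d.+1)%N -> L k l ->
    (`|k| <= P)%N -> (`|l| <= d.+1 - P)%N ->
    (k * P)%:~R * c P.-1 + (l * (d.+1 - P)%N)%:~R * c P = 0.

Lemma bal_form_poisson_mon d c (m m' : mnm) : compatible d c ->
  L (wt m 0) (wt m 1) -> bal_form d c (poisson 'X_[m] 'X_[m']) = 0.
Proof.
move=> cc Lm; rewrite poisson_mon.
have l1 : lift ord0 ord0 = 1 :> 'I_2 by apply: val_inj.
(* If the product is u_1^P u_2^(d + 1 - P), the bracket gives one of the equations in [compatible].
   Otherwise each of its terms has coefficient zero or a monomial that [bal_form] does not read. *)
have [[P [Pd e]]|ne] := pselect (exists P, (P <= d.+1)%N /\ (m + m' = bal P (d.+1 - P))%MM).
  pose PQ (n : 'I_2) := if n == 0 then P else (d.+1 - P)%N.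
  have el n : (m (lshift 2 n) + m' (lshift 2 n) = PQ n)%N.
    by rewrite -mnmDE e bal_l.
  have er n : (m (rshift 2 n) + m' (rshift 2 n) = PQ n)%N.
    by rewrite -mnmDE e bal_r.
  have coef n : (m (lshift 2 n))%:Z * m' (rshift 2 n)
      - (m (rshift 2 n))%:Z * m' (lshift 2 n) = wt m n * PQ n.
    rewrite /wt mulrBl -{1}(er n) -(el n) !PoszD; ring.
  have wl n : (`|wt m n| <= PQ n)%N.
    by rewrite /wt; have := el n; have := er n; lia.
  rewrite e linear_sum big_ord_recl big_ord1 /= l1 !coef !linearZ /=.
  have -> : (bal P (d.+1 - P) - U_(lshift 2 ord0) - U_(rshift 2 ord0) =
             bal P.-1 (d.+1 - P))%MM.
    apply/mnmP; apply: ord22_ind => n; rewrite !(mnmBE, mnm1E) !(bal_l, bal_r).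
      by rewrite eq_rlshift eq_lshift; case: (ord2P n) => -> /=; lia.
    by rewrite eq_lrshift eq_rshift; case: (ord2P n) => -> /=; lia.
  have -> : (bal P (d.+1 - P) - U_(lshift 2 1) - U_(rshift 2 1) =
             bal P (d - P))%MM.
    apply/mnmP; apply: ord22_ind => n; rewrite !(mnmBE, mnm1E) !(bal_l, bal_r).
      by rewrite eq_rlshift eq_lshift; case: (ord2P n) => -> /=; lia.
    by rewrite eq_lrshift eq_rshift; case: (ord2P n) => -> /=; lia.
  have <- := cc _ _ _ Pd Lm (wl 0) (wl 1); congr (_ + _).
    have -> : PQ 0 = P by [].
    (* For P = 0 the truncated monomial has the wrong degree, but its coefficient is zero; likewise
       for the second term at P = d + 1. *)
    case: (posnP P) => [->|P0]; first by rewrite mulr0 scale0r mul0r.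
    have -> : (d.+1 - P = d - P.-1)%N by lia.
    by rewrite bal_form_bal //; lia.
  have -> : PQ 1 = (d.+1 - P)%N by [].
  have [Pd'|Pd'] := leqP P d; first by rewrite bal_form_bal.
  have -> : (d.+1 - P = 0)%N by lia.
  by rewrite mulr0 scale0r mul0r.
rewrite linear_sum big1 // => n _; rewrite linearZ /=.
have [/eqP z|nz] := boolP ((m + m')%MM (lshift 2 n) * (m + m')%MM (rshift 2 n) == 0)%N.
  rewrite (_ : _ - _ = 0) ?scale0r //.
  by move: z; rewrite !mnmDE;
     case: (m (lshift 2 n)) => [|?]; case: (m (rshift 2 n)) => [|?];
     case: (m' (lshift 2 n)) => [|?]; case: (m' (rshift 2 n)) => [|?]; lia.
move: nz; rewrite muln_eq0 negb_or => nz.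
rewrite bal_form_nbal ?scaler0 // => i id e; case: ne.
(* Multiplying a balanced term by u_n again would make m + m' balanced; [z] tells whether the
   exponent of u_1 grows. *)
pose z := nat_of_bool (n == 0); exists (i + z)%N; split.
  by rewrite /z; case: (n == 0); lia.
apply/mnmP => j; rewrite /z; move/mnmP/(_ j): e; move: j nz; apply: ord22_ind => j nz;
  rewrite !(mnmBE, mnm1E) !(bal_l, bal_r) ?eq_rlshift ?eq_lshift ?eq_lrshift ?eq_rshift.
  by move: nz; case: (ord2P n) (ord2P j) => -> [] -> /=; lia.
by move: nz; case: (ord2P n) (ord2P j) => -> [] -> /=; lia.
Qed.

(** Bilinearity reduces a bracket with an invariant to brackets of monomials whose first entry has
    weight in [L]. *)
Lemma bal_form_span d c f : compatible d c ->
  to_span_quot B f = 0 -> bal_form d c f = 0.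
Proof.
move=> cc /eqP; have {1}-> : (0 : HP0 (generated S)) = to_span_quot B 0 by rewrite linear0.
rewrite to_span_quot_eq subr0 => /asboolP [n [a [h [hB ->]]]].
rewrite bal_form_sum big1 // => i _; rewrite linearZ /=.
case: (hB i) => f1 [g1 [/(invariant_generatedP _ SL) f1L ->]].
rewrite poisson_monE bal_form_sum big_seq big1 ?scaler0 // => m /f1L Lm.
rewrite bal_form_sum big1 // => m' _; rewrite linearZ /=.
by rewrite bal_form_poisson_mon ?scaler0.
Qed.

End Functionals.

(** * The dimension as a number of components of a path *)

Section PathDimension.
Variables (K : numFieldType) (S : 'M[K]_2 -> Prop) (L : int -> int -> bool).
Hypothesis SL : trivial_characters S L.
Local Notation OV := {mpoly K[(2 + 2)%N]}.
Local Notation B := (bracket_with_invariant (generated S)).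

Lemma class_homog_ind D (P : HP0 (generated S) -> Prop) (f : OV) :
  P 0 -> (forall x y, P x -> P y -> P (x + y)) -> (forall a x, P x -> P (a *: x)) ->
  (forall i j, (2 * (i + j))%N = D -> P (mon_class S i j)) ->
  f \is D.-homog -> P (to_span_quot B f).
Proof.
move=> P0 PD PZ Pm /dhomogP fD; rewrite (mpolyE f) linear_sum big_seq.
elim/big_ind: _ => // m /fD mD; rewrite linearZ /=; apply: PZ.
have [w0|w0] := eqVneq (wt m 0) 0; last by rewrite (class_wt_neq0 SL w0).
have [w1|w1] := eqVneq (wt m 1) 0; last by rewrite (class_wt_neq0 SL w1).
rewrite (wt0_bal w0 w1); apply: Pm.
by rewrite -mD [in RHS](wt0_bal w0 w1); rewrite -mdeg_bal.
Qed.

Lemma has_dim_deg0 D :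
  (forall i j, (2 * (i + j))%N = D -> mon_class S i j = 0) ->
  has_dim (@HP0_deg K (generated S) D) 0.
Proof.
move=> z; exists (fun=> 0); split=> [[]//|c _ []//|_ [f fD ->]].
exists (fun=> 0); rewrite big_ord0.
apply: (class_homog_ind (P := fun x => x = 0)) fD => // [x y -> ->|a x ->];
  by rewrite ?addr0 ?scaler0.
Qed.

(** Vanishing spreads along the path, first down to the vertex 0 and then up. *)
Lemma mon_class_chain_eq0 d i0 :
  (forall P, (0 < P <= d)%N ->
     mon_class S P.-1 (d - P.-1) = 0 <-> mon_class S P (d - P) = 0) ->
  (i0 <= d)%N -> mon_class S i0 (d - i0) = 0 ->
  forall i, (i <= d)%N -> mon_class S i (d - i) = 0.
Proof.
move=> step i0d z0.
have z : mon_class S 0 (d - 0) = 0.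
  elim: i0 i0d z0 => // i IH id /(step i.+1) /IH; apply; lia.
elim=> // i IH id; apply/(step i.+1); first by lia.
by apply: IH; lia.
Qed.

Lemma has_dim0 d : (forall i, (i <= d)%N -> mon_class S i (d - i) = 0) ->
  has_dim (@HP0_deg K (generated S) (2 * d)) 0.
Proof.
move=> z; apply: has_dim_deg0 => i j ij.
have -> : j = (d - i)%N by lia.
by apply: z; lia.
Qed.

(* [link P] means that the vertices P - 1 and P of the path are identified by the
   vector (kk P, ll P); [alive] is the complement of the killed components. *)
Variables (d : nat) (alive link : pred nat) (kk ll : nat -> int).
Hypothesis linkP : forall P, link P ->
  [/\ (0 < P <= d)%N, L (kk P) (ll P), kk P != 0 /\ ll P != 0,
      (`|kk P| <= P)%N /\ (`|ll P| <= d.+1 - P)%N & alive P.-1 = alive P].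
(** A short vector is parallel to the one chosen at a link, and so gives no new relation, or it
    involves only dead vertices. *)
Hypothesis relP : forall (k l : int) P, (P <= d.+1)%N -> L k l ->
  (`|k| <= P)%N -> (`|l| <= d.+1 - P)%N ->
  (link P /\ k * ll P = l * kk P) \/
  ((k != 0 -> ~~ alive P.-1) /\ (l != 0 -> ~~ alive P)).
Hypothesis deadP : forall i, (i <= d)%N -> ~~ alive i -> mon_class S i (d - i) = 0.

(* Chosen so that [mon_class P.-1 _ / gam P.-1 = mon_class P _ / gam P] whenever
   [P] is linked. *)
Fixpoint gam (P : nat) : K := if P is P'.+1 then
    if link P then - (gam P' * ((kk P * P)%:~R / (ll P * (d.+1 - P)%N)%:~R)) else 1
  else 1.

(** The leftmost vertex of the component of i, used as its representative. *)
Fixpoint head (i : nat) : nat :=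
  if i is i'.+1 then if link i then head i' else i else 0.

Lemma link0 : link 0 = false.
Proof. by apply/negP => /linkP []. Qed.

Lemma link_coef_neq0 P : link P ->
  ((kk P * P)%:~R != 0 :> K) /\ ((ll P * (d.+1 - P)%N)%:~R != 0 :> K).
Proof.
move=> /linkP [Pd _ [k0 l0] _ _]; rewrite !intr_eq0 !mulf_neq0 //.
  by rewrite eqz_nat; lia.
by rewrite eqz_nat; lia.
Qed.

Lemma gam_neq0 P : gam P != 0.
Proof.
elim: P => [|P IH] /=; first exact: oner_neq0.
case: ifP => [lP|_]; last exact: oner_neq0.
by have [h1 h2] := link_coef_neq0 lP; rewrite oppr_eq0 !mulf_neq0 // invr_eq0.
Qed.

Lemma head_le i : (head i <= i)%N.
Proof. by elim: i => //= i IH; case: ifP => // _; apply: leqW. Qed.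

Lemma head_nlink i : ~~ link (head i).
Proof. by elim: i => [|i IH] /=; [rewrite link0|case: ifP => // ->]. Qed.

Lemma head_id i : ~~ link i -> head i = i.
Proof. by case: i => //= i /negPf ->. Qed.

Lemma head_alive i : alive (head i) = alive i.
Proof.
elim: i => //= i IH; case: ifP => // /linkP [_ _ _ _ <-].
by rewrite IH.
Qed.

(** At a link, the ratio of consecutive values of [gam] is the one forced by [mon_class_rel]. *)
Lemma mon_class_head i : (i <= d)%N ->
  mon_class S i (d - i) =
  (gam i / gam (head i)) *: mon_class S (head i) (d - head i).
Proof.
elim: i => [_|i IH id]; first by rewrite divff ?scale1r ?oner_neq0.
have [lP|lP] := boolP (link i.+1); last first.
  by rewrite head_id // divff ?gam_neq0 // scale1r.
have [_ Lkl _ [kP lQ] _] := linkP lP; have [nk nl] := link_coef_neq0 lP.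
have := mon_class_rel SL Lkl kP lQ; rewrite succnK.
have -> : (d.+1 - i.+1).-1 = (d - i.+1)%N by lia.
rewrite subSS (IH (ltnW id)) /= lP => e.
apply: (scalerI nl); move/eqP: e; rewrite addrC addr_eq0 => /eqP ->.
rewrite !scalerA -scaleNr; congr (_ *: _).
have aux (x y g h : K) : x != 0 -> h != 0 ->
    - (y * (g / h)) = x * (- (g * (y / x)) / h).
  by move=> x0 h0; field; rewrite x0 h0.
exact/aux/gam_neq0.
Qed.

(** The vertices counted are the heads of the living components, and their classes form a basis:
    [mon_class_head] gives spanning, and functionals supported on one component give
    independence. *)
Lemma has_dim_path :
  has_dim (@HP0_deg K (generated S) (2 * d))
    (count (fun i => alive i && ~~ link i) (iota 0 d.+1)).
Proof.
set rep := fun i => _; pose s := filter rep (iota 0 d.+1).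
rewrite -size_filter -/s; pose r (a : 'I_(size s)) := nth 0%N s a.
have rP a : [/\ alive (r a), ~~ link (r a) & (r a <= d)%N].
  have : r a \in s by rewrite mem_nth.
  by rewrite mem_filter mem_iota ltnS => /andP [/andP [-> ->] /andP []].
have r_inj a b : r a = r b -> a = b.
  move=> e; apply/val_inj/eqP; rewrite -(nth_uniq 0%N (ltn_ord a) (ltn_ord b)).
    exact/eqP.
  exact/filter_uniq/iota_uniq.
pose e a := mon_class S (r a) (d - r a).
exists e; split.
- move=> a; exists 'X_[bal (r a) (d - r a)] => //.
  rewrite dhomogX; apply/eqP; rewrite /= mdeg_bal; have [_ _] := rP a; lia.
- move=> c ce0 b.
  (* This is [gam] on the component of [r b] and zero elsewhere; the other representatives are heads
     of other components, where it vanishes. *)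
  pose cb i := if alive i && (head i == r b) then gam i else 0.
  have cc : compatible L d cb.
    move=> k l P Pd Lkl kP lQ; have [[lP e1]|[k0 l0]] := relP Pd Lkl kP lQ.
      have [nk nl] := link_coef_neq0 lP.
      case: P lP {Pd kP lQ} nk nl e1 => [|P lP nk nl e1]; first by rewrite link0.
      have [_ _ [_ l0] _ aP] := linkP lP; rewrite /cb -aP succnK /= lP.
      case: ifP => _; last by rewrite !mulr0 addr0.
      (* Clearing the denominator in [gam] leaves the proportionality of (k, l) to the link
         vector. *)
      apply: (mulIf nl); rewrite mul0r mulrDl mulrN mulNr.
      have e2 : k%:~R * (ll P.+1)%:~R = l%:~R * (kk P.+1)%:~R :> K.
        by rewrite -!intrM e1.
      rewrite -[in X in - X]mulrA -[in X in - X]mulrA divfK //.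
      rewrite !intrM; ring: e2.
    have -> : (k * P)%:~R * cb P.-1 = 0 :> K.
      have [->|/k0 /negPf na] := eqVneq k 0; first by rewrite intrM mulr0z !mul0r.
      by rewrite /cb na mulr0.
    have [->|/l0 /negPf na] := eqVneq l 0; first by rewrite intrM mulr0z !mul0r addr0.
    by rewrite /cb na mulr0 addr0.
  have : to_span_quot B (\sum_a c a *: 'X_[bal (r a) (d - r a)]) = 0.
    by rewrite linear_sum -[RHS]ce0; apply: eq_bigr => a _; rewrite linearZ.
  move/(bal_form_span SL cc); rewrite bal_form_sum (bigD1 b) //= big1 ?addr0.
    have [ab lb bd] := rP b.
    rewrite linearZ /= bal_form_bal // /cb ab head_id // eqxx /= => /eqP.
    by rewrite scaler_eq0 (negPf (gam_neq0 _)) orbF => /eqP.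
  move=> a ab; have [aa la ad] := rP a; rewrite linearZ /= bal_form_bal //.
  rewrite /cb head_id // aa; case: eqP => [/r_inj e1|]; last by rewrite scaler0.
  by rewrite e1 eqxx in ab.
pose spanned v := exists c : 'I_(size s) -> K, v = \sum_a c a *: e a.
move=> _ [f fD ->]; apply: (class_homog_ind (P := spanned)) fD.
- by exists (fun=> 0); rewrite big1 // => a _; rewrite scale0r.
- move=> _ _ [c ->] [c' ->]; exists (fun a => c a + c' a).
  by rewrite -big_split; apply: eq_bigr => a _; rewrite scalerDl.
- move=> a _ [c ->]; exists (fun b => a * c b).
  by rewrite scaler_sumr; apply: eq_bigr => b _; rewrite scalerA.
move=> i j ij; have id : (i <= d)%N by lia.
have -> : j = (d - i)%N by lia.
have [ai|/deadP] := boolP (alive i); last first.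
  by move=> -> //; exists (fun=> 0); rewrite big1 // => a _; rewrite scale0r.
have hs : head i \in s.
  rewrite mem_filter mem_iota /rep head_alive ai head_nlink /= add0n ltnS.
  exact: leq_trans (head_le i) id.
pose b : 'I_(size s) := Ordinal (etrans (index_mem _ _) hs).
have rb : r b = head i by rewrite /r nth_index.
exists (fun a => if a == b then gam i / gam (head i) else 0).
rewrite (bigD1 b) //= eqxx big1 ?addr0 => [|a /negPf ->]; last by rewrite scale0r.
by rewrite /e rb; apply: mon_class_head.
Qed.

End PathDimension.

(** * Dimensions for the three families of lattices *)

Section ReflectedLattice.
(* Inverting one of the two diagonal entries of G reflects the lattice; [s] records
   this sign, so that each family of lattices is treated only once. *)
Variables (K : numFieldType) (S : 'M[K]_2 -> Prop) (L : int -> int -> bool) (s : int).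
Hypothesis s_sign : s = 1 \/ s = -1.
Hypothesis SL : trivial_characters S (fun k l => L k (s * l)).

Lemma sign_mulK (l : int) : s * (s * l) = l.
Proof. by case: s_sign => ->; lia. Qed.

Lemma sign_abs (l : int) : `|(s * l)%R|%N = `|l|%N.
Proof. by case: s_sign => ->; lia. Qed.

Lemma sign_neq0 : s != 0.
Proof. by case: s_sign => ->. Qed.

Lemma has_dim_path_sign d (alive link : pred nat) (kk ll : nat -> int) :
  (forall P, link P ->
    [/\ (0 < P <= d)%N, L (kk P) (ll P), kk P != 0 /\ ll P != 0,
        (`|kk P| <= P)%N /\ (`|ll P| <= d.+1 - P)%N & alive P.-1 = alive P]) ->
  (forall (k l : int) P, (P <= d.+1)%N -> L k l ->
    (`|k| <= P)%N -> (`|l| <= d.+1 - P)%N ->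
    (link P /\ k * ll P = l * kk P) \/
    ((k != 0 -> ~~ alive P.-1) /\ (l != 0 -> ~~ alive P))) ->
  (forall i, (i <= d)%N -> ~~ alive i -> mon_class S i (d - i) = 0) ->
  has_dim (@HP0_deg K (generated S) (2 * d))
    (count (fun i => alive i && ~~ link i) (iota 0 d.+1)).
Proof.
move=> linkP relP deadP.
apply: (@has_dim_path _ _ _ SL d _ _ kk (fun P => s * ll P)) => // [P|k l P Pd Lkl kP lQ].
  move=> /linkP [Pd Lkl [k0 l0] [kP lQ] aP].
  by rewrite sign_mulK sign_abs mulf_neq0 ?sign_neq0.
case: (relP k (s * l) P) => //; first by rewrite sign_abs.
  move=> [lP e]; left; split=> //.
  by rewrite mulrCA e !mulrA -[s * s * l]mulrA sign_mulK.
move=> [k0 l0]; right; split=> // ln; apply: l0.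
by rewrite mulf_neq0 ?sign_neq0.
Qed.

Lemma mon_class_rel_sign (k l : int) (P Q : nat) :
  L k l -> (`|k| <= P)%N -> (`|l| <= Q)%N ->
  (k * P)%:~R *: mon_class S P.-1 Q + (s * l * Q)%:~R *: mon_class S P Q.-1 = 0.
Proof.
by move=> kl kP lQ; apply: (mon_class_rel SL); rewrite ?sign_mulK // sign_abs.
Qed.

(** The relation of an axial vector has a single term, with nonzero coefficient. *)
Lemma mon_class_eq0_l k P Q : L k 0 -> k != 0 -> (`|k| <= P)%N ->
  mon_class S P.-1 Q = 0.
Proof.
move=> Lk k0 kP; have := mon_class_rel_sign Lk kP (leq0n Q).
rewrite mulr0 mul0r scale0r addr0 => /eqP.
rewrite scaler_eq0 intr_eq0 mulf_eq0 (negPf k0) => /orP [|/eqP //].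
by move=> /eqP; lia.
Qed.

Lemma mon_class_eq0_r l P Q : L 0 l -> l != 0 -> (`|l| <= Q)%N ->
  mon_class S P Q.-1 = 0.
Proof.
move=> Ll l0 lQ; have := mon_class_rel_sign Ll (leq0n P) lQ.
rewrite mul0r scale0r add0r => /eqP.
rewrite scaler_eq0 intr_eq0 !mulf_eq0 (negPf sign_neq0) (negPf l0).
by move=> /orP [/eqP|/eqP //]; lia.
Qed.

(** Two vectors in one box give two equations for the two neighbours; eliminating the second
    neighbour leaves P times the determinant in front of the first. *)
Lemma mon_class_eq0_indep k l k' l' P Q : L k l -> L k' l' ->
  (`|k| <= P)%N -> (`|l| <= Q)%N -> (`|k'| <= P)%N -> (`|l'| <= Q)%N ->
  k * l' != k' * l -> (0 < P)%N -> mon_class S P.-1 Q = 0.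
Proof.
move=> Lkl Lkl' kP lQ kP' lQ' ind P0.
have e := mon_class_rel_sign Lkl kP lQ; have e' := mon_class_rel_sign Lkl' kP' lQ'.
have : (l' * (k * P))%:~R *: mon_class S P.-1 Q
     = (l * (k' * P))%:~R *: mon_class S P.-1 Q.
  move/eqP: e; rewrite addr_eq0 => /eqP e; move/eqP: e'; rewrite addr_eq0 => /eqP e'.
  rewrite [in LHS]intrM [in RHS]intrM -!scalerA e e' !scalerN !scalerA -!intrM.
  congr (- (_%:~R *: _)).
  by ring.
move/eqP; rewrite -subr_eq0 -scalerBl -intrB scaler_eq0 intr_eq0.
move=> /orP [/eqP e2|/eqP //]; case/eqP: ind.
have P0' : P%:Z != 0 by rewrite eqz_nat; lia.
by apply: (mulIf P0'); move/eqP: e2; rewrite subr_eq0 => /eqP e2; lia.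
Qed.

(** A vector off the axes makes each neighbour a nonzero multiple of the other. *)
Lemma mon_class_link_eq0 k l d P : L k l -> k != 0 -> l != 0 -> (0 < P <= d)%N ->
  (`|k| <= P)%N -> (`|l| <= d.+1 - P)%N ->
  mon_class S P.-1 (d - P.-1) = 0 <-> mon_class S P (d - P) = 0.
Proof.
move=> Lkl k0 l0 Pd kP lQ; have := mon_class_rel_sign Lkl kP lQ.
have -> : (d.+1 - P = d - P.-1)%N by lia.
have -> : ((d - P.-1).-1 = d - P)%N by lia.
have a0 : (k * P)%:~R != 0 :> K by rewrite intr_eq0 mulf_neq0 // eqz_nat; lia.
have b0 : (s * l * (d - P.-1)%N)%:~R != 0 :> K.
  by rewrite intr_eq0 !mulf_neq0 ?sign_neq0 // eqz_nat; lia.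
move=> e; split=> z; move: e; rewrite z scaler0 ?add0r ?addr0 => /eqP;
  by rewrite scaler_eq0 (negPf a0, negPf b0) => /eqP.
Qed.

End ReflectedLattice.

Lemma count_interval a b n m :
  count (fun i => a <= i < b)%N (iota n m) = (minn b (n + m) - maxn a n)%N.
Proof.
elim: m n => [|m IH] n /=; first by lia.
by rewrite IH; case: (leqP a n); case: (ltnP n b) => /=; lia.
Qed.

(* The number of pairs (i, j) with i < a, j < b and i + j = d. *)
Definition rect (a b d : nat) : nat := (minn a d.+1 - (d.+1 - b))%N.

(** For p, q > 1 this differs from [rect p q] in two degrees: the extra short vector (p - 1, 1 - q)
    merges the last two components when d = p + q - 3 and, together with (p, 1), kills the last one
    when d = p + q - 2. *)
Definition pq_sub1_dim (p q d : nat) : nat :=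
  if (d + 3 < p + q)%N then rect p q d else (d + 3 == p + q)%N.

Lemma rectC a b d : rect a b d = rect b a d.
Proof. by rewrite /rect; lia. Qed.

Lemma pq_sub1_dimC a b d : pq_sub1_dim a b d = pq_sub1_dim b a d.
Proof. by rewrite /pq_sub1_dim rectC [(a + b)%N]addnC. Qed.

(** * The lattices for m = pq + 1 and m = pq - 1 *)

Section PQLattices.
Variables (K : numFieldType) (S : 'M[K]_2 -> Prop) (s : int).
Hypothesis s_sign : s = 1 \/ s = -1.

(** The lattice has the basis (p, 1), (1, -q). Below d = p + q - 1 each box contains multiples of at
    most one basis vector and nothing else, so vertices are linked but never killed. *)
Lemma dim_pq_add1 (p q d : nat) : (0 < p)%N -> (0 < q)%N ->
  trivial_characters S (fun k l => ((p * q + 1)%N %| k - p%:Z * (s * l))%Z) ->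
  has_dim (@HP0_deg K (generated S) (2 * d)) (rect p q d).
Proof.
pose L (k l : int) := ((p * q + 1)%N %| k - p%:Z * l)%Z.
move=> p0 q0 SL'; have {SL'} SL : trivial_characters S (fun k l => L k (s * l)) by [].
have Lp : L p 1 by rewrite /L mulr1 subrr dvdz0.
have Lq : L 1 (- q%:Z) by apply/dvdzP; exists 1; lia.
have [hd|hd] := leqP (p + q - 1) d.
  rewrite (_ : rect p q d = 0%N); last by rewrite /rect; lia.
  (* One of the basis vectors fits at every P, so all neighbours are linked; at P = p both fit and
     kill the vertex p - 1. *)
  apply: (has_dim0 SL); apply: (@mon_class_chain_eq0 _ _ d p.-1) => [P Pd||].
  - have [pP|Pp] := leqP p P; first by apply: (mon_class_link_eq0 s_sign SL Lp); lia.
    by apply: (mon_class_link_eq0 s_sign SL Lq); lia.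
  - by lia.
  have -> : (d - p.-1 = d.+1 - p)%N by lia.
  apply: (mon_class_eq0_indep s_sign SL Lp Lq); nia.
pose link P := (0 < P <= d)%N && ((p <= P) || (P + q <= d.+1))%N.
pose kk P : int := if (p <= P)%N then p else 1.
pose ll P : int := if (p <= P)%N then 1 else - q%:Z.
have := @has_dim_path_sign _ _ L s s_sign SL d predT link kk ll.
have -> : count (fun i => predT i && ~~ link i) (iota 0 d.+1) = rect p q d.
  (* The vertex 0, which is never linked, is counted apart; the interval describes the other
     unlinked vertices. *)
  rewrite /= {1}/link /= (@eq_in_count _ _ (fun i => d.+2 - q <= i < p)%N).
    by rewrite count_interval /rect; lia.
  by move=> i; rewrite mem_iota /link /=; lia.
apply=> //.
- move=> P; rewrite /link /kk /ll; case: (leqP p P) => /= pP lP; split=> //; lia.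
- move=> k l P Pd Lkl kP lQ.
  have [c ec] := dvdzP Lkl.
  (* Coordinates in the basis: (k, l) = a (p, 1) + c (1, -q). *)
  pose a := l + c * q; have ek : k = a * p + c by rewrite /a; lia.
  have el : l = a - c * q by rewrite /a; lia.
  have [a0|a0] := eqVneq a 0.
    have [c0|c0] := eqVneq c 0.
      by right; split; rewrite (ek, el) a0 c0.
    left; rewrite /link /kk /ll; case: (leqP p P) => pP; split; nia.
  have [c0|c0] := eqVneq c 0.
    left; rewrite /link /kk /ll; case: (leqP p P) => pP; split; nia.
  (* If a and c are both nonzero, each of the four sign patterns gives |k| + |l| >= p + q, too long
     for the box. *)
  exfalso; have : (`|k| + `|l| <= p + q - 1)%N by lia.
  rewrite ek el; clear -a0 c0 p0 q0.
  have [ap|an] : (0 < a) \/ (a < 0) by lia.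
    have [cp|cn] : (0 < c) \/ (c < 0) by lia.
      have h1 : 0 <= (a - 1) * (p%:Z - 1) by apply: mulr_ge0; lia.
      have h2 : 0 <= (c - 1) * (q%:Z + 1) by apply: mulr_ge0; lia.
      by lia.
    have h1 : 0 <= (a - 1) * (p%:Z + 1) by apply: mulr_ge0; lia.
    have h2 : 0 <= (- c - 1) * (q%:Z - 1) by apply: mulr_ge0; lia.
    by lia.
  have [cp|cn] : (0 < c) \/ (c < 0) by lia.
    have h1 : 0 <= (- a - 1) * (p%:Z + 1) by apply: mulr_ge0; lia.
    have h2 : 0 <= (c - 1) * (q%:Z - 1) by apply: mulr_ge0; lia.
    by lia.
  have h1 : 0 <= (- a - 1) * (p%:Z - 1) by apply: mulr_ge0; lia.
  have h2 : 0 <= (- c - 1) * (q%:Z + 1) by apply: mulr_ge0; lia.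
  by lia.
Qed.

(** The basis is now (p, 1), (1, q). Their difference (p - 1, 1 - q) has 1-norm p + q - 2, so it
    already fits in degree d = p + q - 3, at P = p - 1 only. *)
Lemma dim_pq_sub1 (p q d : nat) : (1 < p)%N -> (1 < q)%N ->
  trivial_characters S (fun k l => ((p * q - 1)%N %| k - p%:Z * (s * l))%Z) ->
  has_dim (@HP0_deg K (generated S) (2 * d)) (pq_sub1_dim p q d).
Proof.
pose L (k l : int) := ((p * q - 1)%N %| k - p%:Z * l)%Z.
move=> p1 q1 SL'; have {SL'} SL : trivial_characters S (fun k l => L k (s * l)) by [].
have pq : (1 < p * q)%N by nia.
have Lp : L p 1 by rewrite /L mulr1 subrr dvdz0.
have eM : (p * q - 1)%N = p%:Z * q - 1 :> int by rewrite -subzn ?PoszM //; lia.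
have Lq : L 1 q by apply/dvdzP; exists (-1); rewrite eM; ring.
have Lpq : L (p%:Z - 1) (1 - q%:Z) by apply/dvdzP; exists 1; rewrite eM; ring.
have [hd|hd] := leqP (p + q - 2) d.
  rewrite (_ : pq_sub1_dim p q d = 0%N); last by rewrite /pq_sub1_dim; case: ltnP => h; lia.
  apply: (has_dim0 SL); apply: (@mon_class_chain_eq0 _ _ d p.-1) => [P Pd||].
  - have [pP|Pp] := leqP p P; first by apply: (mon_class_link_eq0 s_sign SL Lp); lia.
    by apply: (mon_class_link_eq0 s_sign SL Lq); lia.
  - by lia.
  have -> : (d - p.-1 = d.+1 - p)%N by lia.
  apply: (mon_class_eq0_indep s_sign SL Lp Lpq); nia.
(* In the critical degree d = p + q - 3 everything is linked: the basis vectors serve all P except p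
   - 1, where the difference vector serves. *)
pose link P := (0 < P <= d)%N && [|| (p <= P)%N, (P + q <= d.+1)%N | d + 3 == p + q]%N.
pose kk P : int := if (p <= P)%N then p%:Z else if (P + q <= d.+1)%N then 1 else p%:Z - 1.
pose ll P : int := if (p <= P)%N then 1 else if (P + q <= d.+1)%N then q%:Z else 1 - q%:Z.
have := @has_dim_path_sign _ _ L s s_sign SL d predT link kk ll.
have -> : count (fun i => predT i && ~~ link i) (iota 0 d.+1) = pq_sub1_dim p q d.
  rewrite /pq_sub1_dim; case: ltnP => hd'.
    rewrite /= {1}/link /= (@eq_in_count _ _ (fun i => d.+2 - q <= i < p)%N).
      by rewrite count_interval /rect; lia.
    by move=> i; rewrite mem_iota /link /=; lia.
  rewrite /= {1}/link /= (@eq_in_count _ _ pred0) ?count_pred0; first by lia.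
  by move=> i; rewrite mem_iota /link /=; lia.
apply=> //.
- move=> P; rewrite /link /kk /ll; case: (leqP p P) => /= pP;
    last case: (leqP (P + q) d.+1) => /= qP; move=> lP; split=> //; lia.
- move=> k l P Pd Lkl kP lQ.
  have [c] := dvdzP Lkl; rewrite eM => ec.
  pose a := l + c * q; have ek : k = a * p - c by rewrite /a; lia.
  have el : l = a - c * q by rewrite /a; lia.
  have [a0|a0] := eqVneq a 0.
    have [c0|c0] := eqVneq c 0.
      by right; split; rewrite (ek, el) a0 c0.
    left; rewrite /link /kk /ll;
      case: (leqP p P) => pP; case: (leqP (P + q) d.+1) => qP; split; nia.
  have [c0|c0] := eqVneq c 0.
    left; rewrite /link /kk /ll;
      case: (leqP p P) => pP; case: (leqP (P + q) d.+1) => qP; split; nia.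
  have b : (`|k| + `|l| <= p + q - 2)%N by lia.
  (* Here (k, l) = a (p, 1) - c (1, q) with a, c nonzero. The norm bound forces a = c = 1 or a = c =
     -1; all other cases are contradictory. *)
  have [e|e] : (d + 3 = p + q /\ P.+1 = p)%N /\ k * (1 - q%:Z) = l * (p%:Z - 1) \/ False.
    have [ap|an] : (0 < a) \/ (a < 0) by lia.
      have [cp|cn] : (0 < c) \/ (c < 0) by lia.
        have h1 : 0 <= (a - 1) * (p%:Z - 1) by apply: mulr_ge0; lia.
        have h2 : 0 <= (c - 1) * (q%:Z - 1) by apply: mulr_ge0; lia.
        have [a1|a1] : a = 1 \/ 1 <= a - 1 by lia.
          have [c1|c1] : c = 1 \/ 1 <= c - 1 by lia.
            by left; move: b kP lQ; rewrite ek el a1 c1; split; lia.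
          have h3 : 0 <= (c - 2) * (q%:Z - 1) by apply: mulr_ge0; lia.
          by exfalso; lia.
        have h3 : 0 <= (a - 2) * (p%:Z - 1) by apply: mulr_ge0; lia.
        by exfalso; lia.
      have h1 : 0 <= (a - 1) * (p%:Z + 1) by apply: mulr_ge0; lia.
      have h2 : 0 <= (- c - 1) * (q%:Z + 1) by apply: mulr_ge0; lia.
      by exfalso; lia.
    have [cp|cn] : (0 < c) \/ (c < 0) by lia.
      have h1 : 0 <= (- a - 1) * (p%:Z + 1) by apply: mulr_ge0; lia.
      have h2 : 0 <= (c - 1) * (q%:Z + 1) by apply: mulr_ge0; lia.
      by exfalso; lia.
    have h1 : 0 <= (- a - 1) * (p%:Z - 1) by apply: mulr_ge0; lia.
    have h2 : 0 <= (- c - 1) * (q%:Z - 1) by apply: mulr_ge0; lia.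
    have [a1|a1] : a = -1 \/ 1 <= - a - 1 by lia.
      have [c1|c1] : c = -1 \/ 1 <= - c - 1 by lia.
        by left; move: b kP lQ; rewrite ek el a1 c1; split; lia.
      have h3 : 0 <= (- c - 2) * (q%:Z - 1) by apply: mulr_ge0; lia.
      by exfalso; lia.
    have h3 : 0 <= (- a - 2) * (p%:Z - 1) by apply: mulr_ge0; lia.
    by exfalso; lia.
  left; rewrite /link /kk /ll;
      case: (leqP p P) => pP; case: (leqP (P + q) d.+1) => qP; split; lia.
by [].
Qed.

End PQLattices.

(** * Lattices with short vectors on the axes *)

Lemma absz_mul_ge (c : int) (m : nat) : c * m != 0 -> (m <= `|(c * m)%R|)%N.
Proof.
by rewrite mulf_eq0 negb_or abszM => /andP [c0 _]; rewrite leq_pmull // absz_gt0.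
Qed.

Section AxialLattices.
Variables (K : numFieldType) (S : 'M[K]_2 -> Prop) (s : int).
Hypothesis s_sign : s = 1 \/ s = -1.

(** The lattice has the basis (A, 1), (0, m). The axial vector kills the vertices i <= d + 1 - m,
    and (A, 1) links P - 1 to P for P >= A. *)
Lemma dim_mA (m A d : nat) : (0 < m)%N -> (0 < A)%N ->
  trivial_characters S (fun k l => ((m * A)%N %| k - A%:Z * (s * l))%Z) ->
  has_dim (@HP0_deg K (generated S) (2 * d)) (rect A (m - 1) d).
Proof.
pose L (k l : int) := ((m * A)%N %| k - A%:Z * l)%Z.
move=> m0 A0 SL'; have {SL'} SL : trivial_characters S (fun k l => L k (s * l)) by [].
have LA : L A 1 by rewrite /L mulr1 subrr dvdz0.
have Lm : L 0 m by apply/dvdzP; exists (-1); lia.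
have Lm_dead i : (i <= d)%N -> (m + i <= d.+1)%N -> mon_class S i (d - i) = 0.
  move=> id mi; have -> : (d - i = (d.+1 - i).-1)%N by lia.
  by apply: (mon_class_eq0_r s_sign SL i Lm); lia.
have [hd|hd] := leqP (m + A - 2) d.
  rewrite (_ : rect _ _ d = 0%N); last by rewrite /rect; lia.
  (* In these degrees (0, m) kills all vertices below A, and the links carry this to the rest. *)
  apply: (has_dim0 SL); elim=> [|i IH] id; first by apply: Lm_dead; lia.
  have [Ai|iA] := leqP A i.+1; last by apply: Lm_dead; lia.
  have := @mon_class_link_eq0 _ _ _ _ s_sign SL _ _ d i.+1 LA; rewrite succnK => h.
  by apply/h; [lia|lia|lia|lia|lia|apply: IH; lia].
pose alive i := (d.+2 <= m + i)%N.
pose link P := (0 < P <= d)%N && (A <= P)%N.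
have := @has_dim_path_sign _ _ L s s_sign SL d alive link (fun=> A) (fun=> 1).
have -> : count (fun i => alive i && ~~ link i) (iota 0 d.+1) = rect A (m - 1) d.
  rewrite (@eq_in_count _ _ (fun i => d.+2 - m <= i < A)%N).
    by rewrite count_interval /rect; lia.
  by move=> i; rewrite mem_iota /link /alive; lia.
apply.
- by move=> P; rewrite /link /alive => lP; split=> //; lia.
- move=> k l P Pd Lkl kP lQ.
  have [c ec] := dvdzP Lkl.
  pose a := l + c * m; have ek : k = a * A by rewrite /a; lia.
  have [a0|a0] := eqVneq a 0.
    have k0 : k = 0 by rewrite ek a0 mul0r.
    right; rewrite k0 eqxx /alive; split=> // l0.
    have el : l = - c * m by move: a0; rewrite /a; lia.
    by have := @absz_mul_ge (- c) m; rewrite -el => /(_ l0); lia.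
  have el : l = a - c * m by rewrite /a; lia.
  have AP : (A <= P)%N.
    have := @absz_mul_ge a A; rewrite -ek => h; apply: leq_trans (h _) kP.
    by rewrite ek mulf_neq0 // eqz_nat; lia.
  have [c0|c0] := eqVneq c 0; first by left; rewrite /link; split; nia.
  exfalso.
  (* Since a - l is a nonzero multiple of m, |a| + |l| >= m; hence |k| + |l| >= |a| (A - 1) + m >= A
     + m - 1 > d + 1. *)
  have h1 : 0 <= (`|a|%:Z - 1) * (A%:Z - 1) by apply: mulr_ge0; lia.
  have h2 : `|k|%:Z = `|a|%:Z * A by rewrite ek abszM.
  have h3 : (m <= `|a| + `|l|)%N by rewrite el; nia.
  by lia.
by move=> i id; rewrite /alive => ai; apply: Lm_dead => //; lia.
Qed.

(** There are no links: (A, 0) kills the vertices from A - 1 on, and (0, C) those up to d + 1 -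
    C. *)
Lemma dim_product (A C d : nat) : (0 < A)%N -> (0 < C)%N ->
  trivial_characters S (fun k l => (A %| k)%Z && (C %| s * l)%Z) ->
  has_dim (@HP0_deg K (generated S) (2 * d)) (rect (A - 1) (C - 1) d).
Proof.
pose L (k l : int) := (A %| k)%Z && (C %| l)%Z.
move=> A0 C0 SL'; have {SL'} SL : trivial_characters S (fun k l => L k (s * l)) by [].
have LA : L A 0 by rewrite /L dvdzz dvdz0.
have LC : L 0 C by rewrite /L dvdzz dvdz0.
pose alive i := (d.+2 - C <= i < A - 1)%N.
have := @has_dim_path_sign _ _ L s s_sign SL d alive pred0 (fun=> 0) (fun=> 0).
have -> : count (fun i => alive i && ~~ pred0 i) (iota 0 d.+1) = rect (A - 1) (C - 1) d.
  rewrite (@eq_in_count _ _ (fun i => d.+2 - C <= i < A - 1)%N).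
    by rewrite count_interval /rect; lia.
  by move=> i _; rewrite /= andbT.
apply=> //.
  move=> k l P Pd /andP [/dvdzP [a ek] /dvdzP [c el]] kP lQ; right; rewrite /alive.
  split=> n0; first by have := @absz_mul_ge a A; rewrite -ek => /(_ n0); lia.
  by have := @absz_mul_ge c C; rewrite -el => /(_ n0); lia.
move=> i id; rewrite /alive negb_and -ltnNge -leqNgt => /orP [iC|Ai].
  have -> : (d - i = (d.+1 - i).-1)%N by lia.
  by apply: (mon_class_eq0_r s_sign SL i LC); lia.
by apply: (@mon_class_eq0_l _ _ _ _ s_sign SL A i.+1 _ LA); lia.
Qed.

End AxialLattices.

(** * Character lattices of the groups *)

Section RootsOfUnity.
Variable R : realType.
Local Notation pi := (@trigo.pi R).

Lemma expi0 : expi (0 : R) = 1.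
Proof. by rewrite /expi trigo.cos0 trigo.sin0. Qed.

Lemma expiD (x y : R) : expi (x + y) = expi x * expi y.
Proof.
apply/eqP; rewrite eq_complex /= trigo.cosD trigo.sinD.
by rewrite [X in _ && (X == _)]addrC !eqxx.
Qed.

Lemma expi_neq0 (x : R) : expi x != 0.
Proof.
apply: contraTneq (oner_neq0 R[i]) => e.
by rewrite -expi0 -(subrr x) expiD e mul0r eqxx.
Qed.

Lemma expiN (x : R) : expi (- x) = (expi x)^-1.
Proof.
apply: (mulfI (expi_neq0 x)); rewrite divff ?expi_neq0 //.
by rewrite -expiD subrr expi0.
Qed.

Lemma expiX (x : R) (n : nat) : expi (x * n%:R) = expi x ^+ n.
Proof.
elim: n => [|n IH]; first by rewrite mulr0 expi0.
by rewrite -natr1 mulrDr mulr1 expiD IH exprSr.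
Qed.

Lemma expi_exprz (x : R) (k : int) : expi (x * k%:~R) = expi x ^ k.
Proof.
case: k => n; first by rewrite expiX.
by rewrite NegzE rmorphN mulrN expiN expiX exprnN.
Qed.

Lemma expi_2pi : expi (2 * pi) = 1.
Proof.
rewrite mulrC mulr_natr /expi trigo.cos2pi trigo.sin2pi; reflexivity.
Qed.

(** For a remainder 0 < r < n put t = pi r / n; then cos 2t = 1 - 2 sin^2 t < 1 because sin is
    positive on (0, pi). *)
Lemma expi_eq1 (n : nat) (k : int) : (0 < n)%N ->
  (expi (2 * pi * k%:~R / n%:R) == 1) = (n %| k)%Z.
Proof.
move=> n0; have n0' : n%:R != 0 :> R by rewrite pnatr_eq0; lia.
rewrite {1}(divz_eq k n) intrD intrM mulrDr mulrDl expiD.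
rewrite [X in expi X * _](_ : _ = 2 * pi * (k %/ n)%Z%:~R); last first.
  by rewrite -pmulrn; field.
rewrite expi_exprz expi_2pi exp1rz mul1r.
have : (0 <= k %% n)%Z by apply: modz_ge0; lia.
have : (k %% n < n)%Z by apply: ltz_pmod; lia.
have -> : (n %| k)%Z = ((k %% n)%Z == 0) by apply/dvdz_mod0P/eqP.
case: (k %% n)%Z => // r rn _; have [->|r0] := eqVneq r 0%N.
  by rewrite mulr0 mul0r expi0 !eqxx.
apply/idP/idP => [|/eqP]; last by lia.
move=> /eqP [c1 _]; exfalso; move: c1.
set t := pi * r%:R / n%:R.
have -> : 2 * pi * r%:R / n%:R = t *+ 2 by rewrite -[t *+ 2]mulr_natl /t !mulrA.
rewrite trigo.cos_mulr2n trigo.cos2sin2 => c1.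
have : 0 < trigo.sin t.
  apply: trigo.sin_gt0_pi; rewrite /t divr_gt0 ?mulr_gt0 ?trigo.pi_gt0 ?ltr0n //=;
    last by lia.
  by rewrite ltr_pdivrMr ?ltr0n // ltr_pM2l ?trigo.pi_gt0 // ltr_nat.
by nra.
Qed.

End RootsOfUnity.

(** * Hilbert series with even exponents only *)

Lemma coef_even_sum (a b : nat) (f : nat -> nat) (d : nat) :
  ((\sum_(a <= j < b) f j *: 'X^(2 * j) : {poly nat})`_d)%R =
  if ~~ odd d && (a <= d./2 < b)%N then f d./2 else 0%N.
Proof.
rewrite coef_sum; under eq_bigr => j _ do rewrite coefZ coefXn.
have [/andP [od /andP [ad db]]|h] := ifP.
  rewrite (bigD1_seq d./2) /= ?iota_uniq ?mem_index_iota ?ad //.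
  have -> : (d == 2 * d./2)%N by lia.
  rewrite big1 ?addr0 ?mulr1 // => j jd.
  have -> : (d == 2 * j)%N = false by lia.
  by rewrite mulr0.
rewrite big_nat big1 // => j jab.
have -> : (d == 2 * j)%N = false by lia.
by rewrite mulr0.
Qed.

Section Series.
Variables (K : numFieldType) (S : 'M[K]_2 -> Prop) (L : int -> int -> bool).
Hypothesis SL : trivial_characters S L.

Lemma hilbert_series_even (h : {poly nat}) (n : nat -> nat) :
  (forall d, has_dim (@HP0_deg K (generated S) (2 * d)) (n d)) ->
  (forall D, h`_D = if odd D then 0%N else n D./2) ->
  HP0_hilbert_series (generated S) h.
Proof.
move=> hn hE D; rewrite hE; case: ifP => oD.
  by apply: (has_dim_deg0 SL) => i j ij; lia.
by have := hn D./2; rewrite (_ : 2 * D./2 = D)%N //; lia.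
Qed.

End Series.

(** * Characters trivial on the three families of groups *)

Lemma trivial_characters_eq (K : numFieldType) (S : 'M[K]_2 -> Prop) L L' :
  (forall k l, L k l = L' k l) -> trivial_characters S L -> trivial_characters S L'.
Proof.
move=> e [h1 h2]; split=> [M /h1 [a [b [-> a0 b0 h]]]|k l].
  by exists a, b; split=> // k l; rewrite -e; apply: h.
by rewrite -e; apply: h2.
Qed.

Lemma trivial_characters_cyclic (K : numFieldType) (a b : K) L :
  a != 0 -> b != 0 -> (forall k l, (a ^ k * b ^ l == 1) = L k l) ->
  trivial_characters (fun M => M = diag2 a b) L.
Proof.
move=> a0 b0 e; split=> [_ ->|k l].
  by exists a, b; split=> // k l; rewrite -e => /eqP.
by rewrite -e => h; exists a, b.
Qed.

Section Lattices.
Variable R : realType.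
Local Notation pi := (@trigo.pi R).

Lemma sgn_intr (s : bool) : (-1) ^+ s = ((-1) ^+ s : int)%:~R :> R.
Proof. by case: s; rewrite ?expr1 ?expr0 ?mulrN1z. Qed.

Lemma characters_cyclic (r m : nat) (s : bool) : (0 < m)%N ->
  trivial_characters (fun M : 'M[R[i]]_2 =>
       M = diag2 (expi (2 * pi / m%:R))
                 (expi ((-1) ^+ s * (2 * r%:R * pi / m%:R))))
    (fun k l => (m %| k + (-1) ^+ s * (r%:Z * l))%Z).
Proof.
move=> m0; apply: trivial_characters_cyclic; rewrite ?expi_neq0 // => k l.
rewrite -!expi_exprz -expiD -(expi_eq1 R) //; congr (expi _ == 1).
by rewrite sgn_intr !(intrD, intrM) -!pmulrn; ring.
Qed.

Lemma characters_mA (m A : nat) (s : bool) : (0 < m)%N -> (0 < A)%N ->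
  trivial_characters (fun M : 'M[R[i]]_2 =>
       M = diag2 (expi ((-1) ^+ s * (2 * pi / (m * A)%:R)))
                 (expi (2 * pi / m%:R)))
    (fun k l => ((m * A)%N %| (-1) ^+ s * k + A%:Z * l)%Z).
Proof.
move=> m0 A0; apply: trivial_characters_cyclic; rewrite ?expi_neq0 // => k l.
rewrite -!expi_exprz -expiD -(expi_eq1 R) ?muln_gt0 ?m0 //; congr (expi _ == 1).
have A0' : A%:R != 0 :> R by rewrite pnatr_eq0; lia.
have m0' : m%:R != 0 :> R by rewrite pnatr_eq0; lia.
rewrite sgn_intr !(intrD, intrM) -!pmulrn natrM; field.
by rewrite A0' m0'.
Qed.

Lemma characters_product (A C : nat) : (0 < A)%N -> (0 < C)%N ->
  trivial_characters (fun M : 'M[R[i]]_2 =>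
       M = diag2 (expi (2 * pi / A%:R)) 1 \/ M = diag2 1 (expi (2 * pi / C%:R)))
    (fun k l => (A %| k)%Z && (C %| 1 * l)%Z).
Proof.
have ex n k : (0 < n)%N -> (expi (2 * pi / n%:R) ^ k == 1) = (n %| k)%Z.
  by move=> n0; rewrite -expi_exprz -(expi_eq1 R) // mulrAC.
move=> A0 C0; split=> [M [->|->]|k l].
- exists (expi (2 * pi / A%:R)), 1; split; rewrite ?oner_neq0 ?expi_neq0 // => k l.
  by move=> /andP [/=]; rewrite -ex // => /eqP -> _; rewrite exp1rz mulr1.
- exists 1, (expi (2 * pi / C%:R)); split; rewrite ?oner_neq0 ?expi_neq0 // => k l.
  by move=> /andP [_]; rewrite mul1r -ex // => /eqP ->; rewrite exp1rz mulr1.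
rewrite negb_and mul1r => /orP [Ak|Cl].
  exists (expi (2 * pi / A%:R)), 1; rewrite oner_neq0 expi_neq0 exp1rz mulr1 ex //.
  by split=> //; left.
exists 1, (expi (2 * pi / C%:R)); rewrite oner_neq0 expi_neq0 exp1rz mul1r ex //.
by split=> //; right.
Qed.

End Lattices.

(** * Comparison of the dimensions with the stated series *)

Lemma dvdz_congr (m x y z : int) : x = y + z * m -> (m %| x)%Z = (m %| y)%Z.
Proof. by move=> ->; rewrite rpredDr // dvdz_mull. Qed.

(** The antidiagonals of an a by b rectangle grow, stay constant and shrink, which accounts for the
    three sums. *)
Lemma coef_trapezoid (a b : nat) (D : nat) : (a <= b)%N ->
  ((\sum_(0 <= j < a) (j + 1)%N *: 'X^(2 * j)
    + \sum_(a <= j < b) a *: 'X^(2 * j)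
    + \sum_(b <= j < a + b - 1) (a + b - 1 - j)%N *: 'X^(2 * j) : {poly nat})`_D)%R
  = if odd D then 0%N else rect a b D./2.
Proof.
move=> ab; rewrite !coefD !coef_even_sum.
case: (boolP (odd D)) => //= _; move: D./2 => d; rewrite !natrDE /rect.
by do 3!case: ifP; lia.
Qed.

(** The bound 3 <= a keeps the exceptional index a + b - 3 out of the constant range. *)
Lemma coef_trapezoid_pq_sub1 (a b : nat) (D : nat) : (3 <= a <= b)%N ->
  ((\sum_(0 <= j < a) (j + 1)%N *: 'X^(2 * j)
    + \sum_(a <= j < b) a *: 'X^(2 * j)
    + \sum_(b <= j < a + b - 3) (a + b - 1 - j)%N *: 'X^(2 * j)
    + 'X^(2 * a + 2 * b - 6) : {poly nat})`_D)%R
  = if odd D then 0%N else pq_sub1_dim a b D./2.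
Proof.
move=> /andP [a3 ab]; rewrite !coefD !coef_even_sum coefXn natn.
have -> : (D == 2 * a + 2 * b - 6)%N = ~~ odd D && (D./2 + 3 == a + b)%N by lia.
case: (boolP (odd D)) => //= _; move: D./2 => d; rewrite !natrDE /pq_sub1_dim /rect.
by do 4!case: ifP; lia.
Qed.

Theorem corollary6p3 (R : realType) :
  (* (1) *)
  (forall (r m p0 q0 : nat) (s : bool),
     (0 < r)%N -> (0 < m)%N -> coprime r m ->
     (r %| m + 1)%N \/ (r %| m - 1)%N ->
     (r != 1 %[mod m])%Z -> (r != - 1 %[mod m])%Z ->
     cyclic_pair m r p0 q0 ->
     let G := generated (fun M : 'M[R[i]]_2 =>
       M = diag2 (expi (2 * trigo.pi / m%:R))
                 (expi ((-1) ^+ s * (2 * r%:R * trigo.pi / m%:R)))) in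
     let p := minn p0 q0 in
     let q := maxn p0 q0 in
     ((p * q + 1 = m)%N ->
      HP0_hilbert_series G
        (\sum_(0 <= j < p) (j + 1)%N *: 'X^(2 * j)
         + \sum_(p <= j < q) p *: 'X^(2 * j)
         + \sum_(q <= j < p + q - 1) (p + q - 1 - j)%N *: 'X^(2 * j)))
     /\
     ((p * q - 1 = m)%N ->
      HP0_hilbert_series G
        (\sum_(0 <= j < p) (j + 1)%N *: 'X^(2 * j)
         + \sum_(p <= j < q) p *: 'X^(2 * j)
         + \sum_(q <= j < p + q - 3) (p + q - 1 - j)%N *: 'X^(2 * j)
         + 'X^(2 * p + 2 * q - 6))))
  /\
  (* (2) *)
  (forall (m A : nat) (s : bool),
     (0 < m)%N -> (0 < A)%N ->
     let G := generated (fun M : 'M[R[i]]_2 =>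
       M = diag2 (expi ((-1) ^+ s * (2 * trigo.pi / (m * A)%:R)))
                 (expi (2 * trigo.pi / m%:R))) in
     ((m <= A)%N ->
      HP0_hilbert_series G
        (\sum_(0 <= j < m - 1) (j + 1)%N *: 'X^(2 * j)
         + \sum_(m - 1 <= j < A) (m - 1)%N *: 'X^(2 * j)
         + \sum_(A <= j < m + A - 2) (m + A - 2 - j)%N *: 'X^(2 * j)))
     /\
     ((A < m)%N ->
      HP0_hilbert_series G
        (\sum_(0 <= j < A) (j + 1)%N *: 'X^(2 * j)
         + \sum_(A <= j < m - 1) A *: 'X^(2 * j)
         + \sum_(m - 1 <= j < m + A - 2) (m + A - 2 - j)%N *: 'X^(2 * j))))
  /\
  (* (3) *)
  (forall (A0 B0 : nat),
     (0 < A0)%N -> (0 < B0)%N ->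
     let G := generated (fun M : 'M[R[i]]_2 =>
       M = diag2 (expi (2 * trigo.pi / A0%:R)) 1
       \/ M = diag2 1 (expi (2 * trigo.pi / B0%:R))) in
     let A := maxn A0 B0 in
     let B := minn A0 B0 in
     HP0_hilbert_series G
       (\sum_(0 <= j < B - 1) (j + 1)%N *: 'X^(2 * j)
        + \sum_(B - 1 <= j < A - 1) (B - 1)%N *: 'X^(2 * j)
        + \sum_(A - 1 <= j < A + B - 3) (A + B - 3 - j)%N *: 'X^(2 * j))).
Proof.
split; last split.
- move=> r m p q s r0 m0 _ _ _ _ [[p1 pm] [q1 qm] pr _].
  (* As p is r or -r modulo m, this sign and that of the generator combine into one sign [t]. *)
  have [t [t_sign tE]] : exists t : int, (t = 1 \/ t = -1) /\
      forall k l : int, (m %| k + (-1) ^+ s * (r%:Z * l))%Z = (m %| k - p%:Z * (t * l))%Z.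
    case: pr => /eqP; rewrite eqz_mod_dvd => /dvdzP [c ec].
      exists (- (-1) ^+ s); split=> [|k l]; first by case: (s); [left|right].
      have ep : p%:Z = r%:Z + c * m by lia.
      by apply: (@dvdz_congr _ _ _ (- c * (-1) ^+ s * l)); rewrite ep; ring.
    exists ((-1) ^+ s); split=> [|k l]; first by case: (s); [right|left].
    have ep : p%:Z = - r%:Z + c * m by lia.
    by apply: (@dvdz_congr _ _ _ (c * (-1) ^+ s * l)); rewrite ep; ring.
  have SL := trivial_characters_eq tE (@characters_cyclic R r m s m0).
  (* Here p and q are unsorted, since p must stay the one congruent to r or -r; symmetry of the
     dimension formulas allows sorting at the end. *)
  have pq : (minn p q * maxn p q = p * q)%N by case: (leqP p q) => _; rewrite // mulnC.
  split; rewrite pq => em.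
    apply: (hilbert_series_even SL (n := rect p q)) => [d|D].
      by apply: (dim_pq_add1 t_sign); rewrite ?em //; lia.
    by case: (leqP p q) => pq'; rewrite coef_trapezoid 1?rectC // ltnW.
  (* If p = 2 then m = 2 q - 1, against 2 q < m. *)
  have p3 : (2 < p)%N.
    rewrite ltn_neqAle p1 andbT; apply/eqP => p2; move: em qm; rewrite -p2; lia.
  have q3 : (2 < q)%N.
    rewrite ltn_neqAle q1 andbT; apply/eqP => q2; move: em pm; rewrite -q2; lia.
  apply: (hilbert_series_even SL (n := pq_sub1_dim p q)) => [d|D].
    by apply: (dim_pq_sub1 t_sign d p1 q1); rewrite em.
  by case: (leqP p q) => pq'; rewrite coef_trapezoid_pq_sub1 1?pq_sub1_dimC //; lia.
- move=> m A s m0 A0.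
  have e : forall k l : int, ((m * A)%N %| (-1) ^+ s * k + A%:Z * l)%Z =
      ((m * A)%N %| k - A%:Z * (- (-1) ^+ s * l))%Z.
    move=> k l; case: s => /=; last by congr (_ %| _)%Z; ring.
    by rewrite -[RHS]rpredN; congr (_ %| _)%Z; ring.
  have SL := trivial_characters_eq e (@characters_mA R m A s m0 A0).
  have s_sign : - (-1) ^+ s = 1 :> int \/ - (-1) ^+ s = -1 :> int.
    by case: (s); [left|right].
  have hd d := dim_mA s_sign d m0 A0 SL.
  have e2 : (m + A - 2 = m - 1 + A - 1)%N by lia.
  split=> mA; apply: (hilbert_series_even SL hd) => D.
    by rewrite e2 rectC coef_trapezoid //; lia.
  by rewrite e2 [(m - 1 + A)%N]addnC coef_trapezoid //; lia.
move=> A C A0 C0; have SL := @characters_product R A C A0 C0.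
apply: (hilbert_series_even SL (n := rect (A - 1) (C - 1))) => [d|D].
  by apply: (dim_product (s := 1)) => //; left.
(* For A = C = 1 both truncated differences are 0, so the identity persists. *)
have -> : (maxn A C + minn A C - 3 = minn A C - 1 + (maxn A C - 1) - 1)%N by lia.
have -> : rect (A - 1) (C - 1) D./2 = rect (minn A C - 1) (maxn A C - 1) D./2.
  by case: (leqP A C) => _ //; rewrite rectC.
by rewrite coef_trapezoid //; lia.
Qed.
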